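(* Let $n>2$ and $t>2$ be two positive integers. Then \[\varphi(C_n\boxdot S_t)=\begin{cases} 2n, & \text{if } n\leq \left\lfloor\frac {t+3}2\right\rfloor,\\ t+3, & \text{if } \left\lfloor\frac {t+3}2\right\rfloor< n \leq t+2,\\ n, & \text{if } t+3\leq n\leq 2t+4,\\ 2t+5, & \text{otherwise}. \end{cases}\]
   Context: All graphs are finite and simple. $C_n$ denotes the cycle with $n$ vertices and $S_t$ denotes the star with $t$ leaves (so it has $t+1$ vertices). The subdivision graph $S(G)$ of a graph $G$ is obtained by inserting one new vertex into every edge of $G$. For graphs $G$ and $H$, with $V(G)=\{u_0,\ldots,u_{m-1}\}$, the subdivision-vertex neighbourhood corona (SVN corona) $G\boxdot H$ is the graph obtained from $S(G)$ by adding $m$ vertex-disjoint copies of $H$ (one for each $u_i$) and joining, for each $i$, every vertex of $N_{S(G)}(u_i)$ (the neighbourhood of $u_i$ in $S(G)$) to every vertex of the copy of $H$ associated with $u_i$. A $b$-chromatic coloring of a graph with $k$ colors is a proper coloring with colors $0,\ldots,k-1$ such that, for each color $i$, there is a vertex (a $b$-vertex) of color $i$ having, for each color $j\neq i$, a neighbour of color $j$. The $b$-chromatic number $\varphi(G)$ is the maximum $k$ for which $G$ has a $b$-chromatic coloring with $k$ colors. *)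

(* Defs.v *)
From mathcomp Require Import all_boot.

Set Implicit Arguments.
Unset Strict Implicit.
Unset Printing Implicit Defensive.

Record sgraph := SGraph {
  vertex :> finType;
  adj : rel vertex;
  adj_sym : symmetric adj;
  adj_irrefl : irreflexive adj
}.

(* The conjunct [i != j] only matters for n = 1. *)
Definition cycle_adj (n : nat) : rel 'I_n :=
  fun i j => (i != j) && ((j == i.+1 %% n :> nat) || (i == j.+1 %% n :> nat)).

Lemma cycle_adj_sym n : symmetric (@cycle_adj n).
Proof. by move=> i j; rewrite /cycle_adj eq_sym orbC. Qed.

Lemma cycle_adj_irrefl n : irreflexive (@cycle_adj n).
Proof. by move=> i; rewrite /cycle_adj eqxx. Qed.

Definition cycle_graph (n : nat) : sgraph :=
  SGraph (@cycle_adj_sym n) (@cycle_adj_irrefl n).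

(* [None] is the centre, [Some i] are the leaves. *)
Definition star_adj (t : nat) : rel (option 'I_t) :=
  fun x y => (x == None) != (y == None).

Lemma star_adj_sym t : symmetric (@star_adj t).
Proof. by move=> x y; rewrite /star_adj eq_sym. Qed.

Lemma star_adj_irrefl t : irreflexive (@star_adj t).
Proof. by move=> x; rewrite /star_adj eqxx. Qed.

Definition star_graph (t : nat) : sgraph :=
  SGraph (@star_adj_sym t) (@star_adj_irrefl t).

Definition is_edge (G : sgraph) (A : {set G}) : bool :=
  [exists x, exists y, adj x y && (A == [set x; y])].

Definition edge (G : sgraph) := {A : {set G} | is_edge A}.

Definition subdivision_adj (G : sgraph) : rel (G + edge G)%type :=
  fun a b => match a, b with
  | inl x, inr e => x \in val e
  | inr e, inl x => x \in val e
  | _, _ => false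
  end.

Lemma subdivision_adj_sym G : symmetric (@subdivision_adj G).
Proof. by case=> [x|e] [y|f]. Qed.

Lemma subdivision_adj_irrefl G : irreflexive (@subdivision_adj G).
Proof. by case. Qed.

Definition subdivision (G : sgraph) : sgraph :=
  SGraph (@subdivision_adj_sym G) (@subdivision_adj_irrefl G).

(* [inr (u, h)] is the vertex [h] in the copy of [H] associated with [u]. *)
Definition svn_corona_adj (G H : sgraph) : rel (subdivision G + G * H)%type :=
  fun a b => match a, b with
  | inl x, inl y => adj x y
  | inl x, inr (u, _) => adj (inl u : subdivision G) x
  | inr (u, _), inl x => adj (inl u : subdivision G) x
  | inr (u, h), inr (v, k) => (u == v) && adj h k
  end.

Lemma svn_corona_adj_sym G H : symmetric (@svn_corona_adj G H).
Proof.
case=> [x|[u h]] [y|[v k]] //=; first exact: subdivision_adj_sym.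
by rewrite eq_sym adj_sym.
Qed.

Lemma svn_corona_adj_irrefl G H : irreflexive (@svn_corona_adj G H).
Proof. case=> [x|[u h]] /=; first exact: subdivision_adj_irrefl.
by rewrite adj_irrefl andbF. Qed.

Definition svn_corona (G H : sgraph) : sgraph :=
  SGraph (@svn_corona_adj_sym G H) (@svn_corona_adj_irrefl G H).

Definition proper_coloring (G : sgraph) k (c : {ffun G -> 'I_k}) : bool :=
  [forall x, forall y, adj x y ==> (c x != c y)].

Definition b_vertex (G : sgraph) k (c : {ffun G -> 'I_k}) (x : G) : bool :=
  [forall j, (j != c x) ==> [exists y, adj x y && (c y == j)]].

Definition b_coloring (G : sgraph) k (c : {ffun G -> 'I_k}) : bool :=
  proper_coloring c && [forall i, exists x, (c x == i) && b_vertex c x].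

Definition b_colorable (G : sgraph) (k : nat) : bool :=
  [exists c : {ffun G -> 'I_k}, b_coloring c].

Lemma b_colorable_card (G : sgraph) k : b_colorable G k -> k <= #|G|.
Proof.
case/existsP=> c /andP[_ /forallP bc]; rewrite -[k]card_ord.
apply: leq_trans (leq_image_card c G); apply/subset_leq_card/subsetP => i _.
by case/existsP: (bc i) => x /andP[/eqP <- _]; apply: image_f.
Qed.

(* The bound on k loses nothing, by [b_colorable_card]. *)
Definition b_chromatic_number (G : sgraph) : nat :=
  \max_(k < #|G|.+1 | b_colorable G k) k.

(* Main.v *)
Require Import Defs.
From mathcomp Require Import all_boot zify.

(** Write e_i for the subdivision vertex of the i-th edge of the cycle and c_i
    for the centre of the i-th star.  Only the e_i (degree 2t+4) and the c_i
    (degree t+2) have degree more than 3, so counting the possible b-vertices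
    gives every upper bound.
    For the lower bound when n < t+3, give the e_i distinct colors, some c_i
    the remaining ones, and let every star show all colors but those of its
    two neighbours e_(i-1) and e_i.  When n >= t+3, use k = min(n, 2t+5) colors
    cyclically: e_i gets color i, the i-th star the colors i+1, i+3, i+5, ...
    and u_i color i-2 modulo k, so that e_i sees i+1, i+2, ..., i+k-1. *)

Set Implicit Arguments.
Unset Strict Implicit.
Unset Printing Implicit Defensive.

(** * General facts on b-colorings *)

Lemma b_colorable_chromatic (G : sgraph) m :
    b_colorable G m -> (forall k, b_colorable G k -> k <= m) ->
  b_chromatic_number G = m.
Proof.
move=> bm ub; apply/eqP; rewrite eqn_leq; apply/andP; split.
  by apply/bigmax_leqP => k /ub.
have mG : m < #|G|.+1 by rewrite ltnS b_colorable_card.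
exact: (@leq_bigmax_cond _ (fun k : 'I_#|G|.+1 => b_colorable G k)
  (fun k => k : nat) (Ordinal mG)).
Qed.

(** Every color occurs at [x] or at one of its neighbours, so the colors of [x :: s] exhaust ['I_k].
    Any list covering the neighbourhood will do, which spares computing exact degrees. *)
Lemma b_vertex_degree (G : sgraph) k (c : {ffun G -> 'I_k}) x (s : seq G) :
  b_vertex c x -> (forall y, adj x y -> y \in s) -> k <= (size s).+1.
Proof.
move=> /forallP bx sub; rewrite -[k]card_ord -(size_map c s).
rewrite -[X in _ <= X]/(size (c x :: map c s)).
apply: leq_trans (card_size _); apply/subset_leq_card/subsetP => j _.
rewrite inE; have [//|jx] := eqVneq j (c x).
have /existsP[y /andP[/sub ys /eqP <-]] := implyP (bx j) jx.
exact: map_f.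
Qed.

Lemma adj_edge_proof (G : sgraph) (x y : G) : adj x y -> is_edge [set x; y].
Proof.
move=> xy; apply/existsP; exists x; apply/existsP; exists y.
by rewrite xy eqxx.
Qed.

(** * Edges of the cycle and neighbourhoods in the corona *)

Section Corona.

Variables (n t : nat).
Hypothesis hn : 2 < n.

Let C := cycle_graph n.
Let K := svn_corona C (star_graph t).

Lemma ordS_neq (i : 'I_n) : ordS i != i.
Proof.
apply/eqP => /(congr1 val) /=; have := ltn_ord i; rewrite leq_eqVlt.
case/predU1P => [e|lt]; first by rewrite e modnn; lia.
by rewrite modn_small //; lia.
Qed.

Lemma ord_pred_neq (i : 'I_n) : ord_pred i != i.
Proof.
by apply: contra (ordS_neq (ord_pred i)) => /eqP e; rewrite ord_predK e.
Qed.

(** Here [2 < n] is essential: it separates the two cycle neighbours of a vertex, so that distinct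
    indices give distinct edges. *)
Lemma ordS_ordS_neq (i : 'I_n) : ordS (ordS i) != i.
Proof.
apply/eqP => /(congr1 val) /=; have := ltn_ord i; rewrite leq_eqVlt.
case/predU1P => [e|lt]; first by rewrite e modnn modn_small; lia.
rewrite (modn_small lt); move: lt; rewrite leq_eqVlt.
case/predU1P => [e|lt]; first by rewrite e modnn; lia.
by rewrite modn_small //; lia.
Qed.

Lemma cycle_adjE (i j : 'I_n) :
  adj (i : C) j = (j == ordS i) || (i == ordS j).
Proof.
rewrite /= /cycle_adj -!val_eqE /=; have [e|//] := eqVneq (i : nat) j.
by have /negbTE/= := ordS_neq i; rewrite -e orbb eq_sym -val_eqE /= => ->.
Qed.

Lemma cycle_edge_proof (i : 'I_n) : is_edge [set (i : C); ordS i].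
Proof. by apply: adj_edge_proof; rewrite cycle_adjE eqxx. Qed.

Definition cycle_edge (i : 'I_n) : edge C := Sub _ (cycle_edge_proof i).

Lemma in_cycle_edge (x : C) i :
  (x \in val (cycle_edge i)) = (x == i) || (x == ordS i).
Proof. by rewrite SubK !inE. Qed.

Lemma cycle_edge_surj (e : edge C) : exists i, cycle_edge i == e.
Proof.
case: e => A eA; have /existsP[x /existsP[y /andP[]]] := eA.
rewrite cycle_adjE => xy /eqP AE.
case/orP: xy => /eqP xy; [exists x | exists y]; rewrite -val_eqE /= AE xy //.
by rewrite setUC.
Qed.

Lemma cycle_edge_inj : injective cycle_edge.
Proof.
move=> i j e; have := in_cycle_edge i i; rewrite eqxx e in_cycle_edge.
case/orP => /eqP // ij; have := in_cycle_edge (ordS i) i.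
by rewrite eqxx orbT e in_cycle_edge ij (negbTE (ordS_ordS_neq j))
   (negbTE (ordS_neq _)).
Qed.

(** Edges are sets of vertices; this inverse of [cycle_edge] numbers them, so that they can be
    colored by index. *)
Definition edge_index (e : edge C) : 'I_n := xchoose (cycle_edge_surj e).

Lemma edge_indexK : cancel edge_index cycle_edge.
Proof. by move=> e; apply/eqP/(xchooseP (cycle_edge_surj e)). Qed.

Lemma cycle_edgeK : cancel cycle_edge edge_index.
Proof. by move=> i; apply: cycle_edge_inj; rewrite edge_indexK. Qed.

Lemma in_edge (x : C) (e : edge C) :
  (x \in val e) = (x == edge_index e) || (x == ordS (edge_index e)).
Proof. by rewrite -{1}[e]edge_indexK in_cycle_edge. Qed.

Definition cvert (i : 'I_n) : K := inl (inl (i : C)).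
Definition evert (i : 'I_n) : K := inl (inr (cycle_edge i)).
Definition svert (i : 'I_n) (h : option 'I_t) : K :=
  inr (i : C, h : star_graph t).

Lemma corona_ind (P : K -> Prop) :
    (forall i, P (cvert i)) -> (forall i, P (evert i)) ->
    (forall i h, P (svert i h)) ->
  forall x, P x.
Proof.
move=> Pc Pe Ps [[i|e]|[i h]]; [exact: Pc | | exact: Ps].
by rewrite -[e]edge_indexK; apply: Pe.
Qed.

Lemma evert_nbr i y :
  adj (evert i) y ->
  y \in [:: cvert i; cvert (ordS i)] ++
        map (svert i) (enum {: option 'I_t}) ++
        map (svert (ordS i)) (enum {: option 'I_t}).
Proof.
elim/corona_ind: y => [j|j|j h] //; rewrite [adj _ _]/= in_cycle_edge;
  case/orP => /eqP ->; rewrite !mem_cat ?inE ?eqxx ?orbT //.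
  by rewrite map_f ?mem_enum ?orbT.
by rewrite [svert (ordS i) h \in map (svert (ordS i)) _]map_f ?mem_enum ?orbT.
Qed.

Lemma edge_nbr (i j : 'I_n) :
  (i : C) \in val (cycle_edge j) ->
  evert j \in [:: evert i; evert (ord_pred i)].
Proof.
rewrite in_cycle_edge => /orP[] /eqP ->; rewrite !inE ?ordSK eqxx ?orbT //.
Qed.

Lemma cvert_nbr i y :
  adj (cvert i) y -> y \in [:: evert i; evert (ord_pred i)].
Proof.
by elim/corona_ind: y => [j|j|j h] //; rewrite [adj _ _]/=; apply: edge_nbr.
Qed.

Lemma centre_nbr i y :
  adj (svert i None) y ->
  y \in [:: evert i; evert (ord_pred i)] ++
        map (svert i \o some) (enum 'I_t).
Proof.
elim/corona_ind: y => [j|j|j [h|]] //; rewrite [adj _ _]/=.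
- by move=> /edge_nbr; rewrite mem_cat => ->.
- move=> /andP[/eqP <- _]; rewrite mem_cat.
  by rewrite (map_f (svert i \o some)) ?mem_enum ?orbT.
- by rewrite andbF.
Qed.

Lemma leaf_nbr i j y :
  adj (svert i (Some j)) y ->
  y \in [:: evert i; evert (ord_pred i); svert i None].
Proof.
elim/corona_ind: y => [l|l|l [h|]] //; rewrite [adj _ _]/=.
- by move=> /edge_nbr; rewrite !inE orbA => ->.
- by rewrite andbF.
- by move=> /andP[/eqP <- _]; rewrite !inE eqxx !orbT.
Qed.

(** * Upper bounds from counting possible b-vertices *)

Section UpperBounds.

Variables (k : nat) (c : {ffun K -> 'I_k}).

Lemma b_vertex_leq x : b_vertex c x -> k <= 2 * t + 5.
Proof.
elim/corona_ind: x => [i|i|i [j|]] bx.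
- by have := b_vertex_degree bx (@cvert_nbr i); rewrite /=; lia.
- have := b_vertex_degree bx (@evert_nbr i).
  by rewrite !size_cat !size_map -?enumT -!cardE card_option card_ord /=; lia.
- by have := b_vertex_degree bx (@leaf_nbr i j); rewrite /=; lia.
- have := b_vertex_degree bx (@centre_nbr i).
  by rewrite !size_cat !size_map -?enumT -!cardE card_ord /=; lia.
Qed.

(** A centre has degree t+2 and so serves at most t+3 colors; cycle vertices and leaves serve at
    most 4, which is at most t+3 as t is positive. *)
Lemma b_vertex_edge x :
  0 < t -> b_vertex c x -> t + 3 < k -> exists i, x = evert i.
Proof.
move=> ht; elim/corona_ind: x => [i|i|i [j|]] bx kt; last 2 first.
- by have := b_vertex_degree bx (@leaf_nbr i j); rewrite /=; lia.
- have := b_vertex_degree bx (@centre_nbr i).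
  by rewrite !size_cat !size_map -?enumT -!cardE card_ord /=; lia.
- by have := b_vertex_degree bx (@cvert_nbr i); rewrite /=; lia.
- by exists i.
Qed.

Lemma b_vertex_edge_or_centre x :
  b_vertex c x -> 4 < k -> exists i, x = evert i \/ x = svert i None.
Proof.
elim/corona_ind: x => [i|i|i [j|]] bx kt.
- by have := b_vertex_degree bx (@cvert_nbr i); rewrite /=; lia.
- by exists i; left.
- by have := b_vertex_degree bx (@leaf_nbr i j); rewrite /=; lia.
- by exists i; right.
Qed.

Hypothesis bc : b_coloring c.

Lemma ex_b_vertex a : exists2 x, c x = a & b_vertex c x.
Proof.
case/andP: bc => _ /forallP/(_ a)/existsP[x /andP[/eqP ca bx]].
by exists x.
Qed.

Lemma colors_leq : k <= 2 * t + 5.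
Proof.
case: (posnP k) => [->//|k0].
by have [x _ /b_vertex_leq] := ex_b_vertex (Ordinal k0).
Qed.

Lemma colors_edge_leq : 0 < t -> t + 3 < k -> k <= n.
Proof.
move=> t0 kt; rewrite -[k]card_ord -[n]card_ord.
apply: leq_trans (leq_image_card (c \o evert) predT).
apply/subset_leq_card/subsetP => a _; have [x <- bx] := ex_b_vertex a.
by have [i ->] := b_vertex_edge t0 bx kt; apply: (image_f (c \o evert)).
Qed.

(** With more than 4 colors, each color needs its own b-vertex among n subdivision vertices and n
    centres; the boolean in [f] tells the two kinds apart. *)
Lemma colors_edge_or_centre_leq : 4 < k -> k <= 2 * n.
Proof.
move=> k4; rewrite -[k]card_ord -[n]card_ord -card_bool mulnC -card_prod.
pose f (p : 'I_n * bool) := c (if p.2 then evert p.1 else svert p.1 None).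
apply: leq_trans (leq_image_card f predT).
apply/subset_leq_card/subsetP => a _; have [x <- bx] := ex_b_vertex a.
have [i [] ->] := b_vertex_edge_or_centre bx k4.
  exact: (image_f f (x := (i, true))).
exact: (image_f f (x := (i, false))).
Qed.

End UpperBounds.

(** * A criterion for b-colorings given by index *)

Section Coloring.

Variables (k : nat) (ce cu : 'I_n -> 'I_k) (cs : 'I_n -> option 'I_t -> 'I_k).

Definition corona_coloring (x : K) : 'I_k :=
  match x with
  | inl (inl i) => cu i
  | inl (inr e) => ce (edge_index e)
  | inr (i, h) => cs i h
  end.

Hypothesis cuP : forall i, cu i != ce i /\ cu (ordS i) != ce i.
Hypothesis csP : forall i h, cs i h != ce i /\ cs (ordS i) h != ce i.
Hypothesis starP : forall i j, cs i None != cs i (Some j).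

Definition edge_dominates i :=
  forall b, b != ce i ->
  [\/ cu i = b, cu (ordS i) = b, exists h, cs i h = b
   | exists h, cs (ordS i) h = b].

Definition centre_dominates i :=
  forall b, b != cs i None ->
  [\/ ce i = b, ce (ord_pred i) = b | exists j, cs i (Some j) = b].

Lemma corona_b_colorable :
    (forall a, (exists2 i, ce i = a & edge_dominates i) \/
               (exists2 i, cs i None = a & centre_dominates i)) ->
  b_colorable K k.
Proof.
move=> dom; apply/existsP; exists [ffun x => corona_coloring x].
have col x : [ffun x => corona_coloring x] x = corona_coloring x.
  by rewrite ffunE.
apply/andP; split.
  have ue (i : 'I_n) (e : edge C) : (i : C) \in val e ->
      cu i != ce (edge_index e).
    by rewrite in_edge => /orP[] /eqP -> ; case: (cuP (edge_index e)).
  have se (i : 'I_n) h (e : edge C) : (i : C) \in val e ->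
      cs i h != ce (edge_index e).
    by rewrite in_edge => /orP[] /eqP -> ; case: (csP (edge_index e) h).
  apply/forallP => x; apply/forallP => y; apply/implyP; rewrite !col.
  case: x y => [[i|e]|[i h]] [[j|f]|[j l]] //=; try by [apply: ue | apply: se].
  - by rewrite eq_sym; apply: ue.
  - by rewrite eq_sym; apply: se.
  - case/andP=> /eqP <-; case: h l => [h|] [l|] //= _.
    by rewrite eq_sym; apply: starP.
apply/forallP => a; apply/existsP.
have [[i <- edom]|[i <- cdom]] := dom a.
  exists (evert i); rewrite col /= cycle_edgeK eqxx.
  apply/forallP => b; rewrite col /= cycle_edgeK; apply/implyP => /edom bP.
  apply/existsP; case: bP => [<-|<-|[h <-]|[h <-]].
  - by exists (cvert i); rewrite col /= in_cycle_edge !eqxx.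
  - by exists (cvert (ordS i)); rewrite col /= in_cycle_edge !eqxx orbT.
  - by exists (svert i h); rewrite col /= in_cycle_edge !eqxx.
  - by exists (svert (ordS i) h); rewrite col /= in_cycle_edge !eqxx orbT.
exists (svert i None); rewrite col /= eqxx.
apply/forallP => b; rewrite col /=; apply/implyP => /cdom bP.
apply/existsP; case: bP => [<-|<-|[j <-]].
- by exists (evert i); rewrite col /= in_cycle_edge cycle_edgeK !eqxx.
- exists (evert (ord_pred i)); rewrite col /= in_cycle_edge cycle_edgeK.
  by rewrite ord_predK !eqxx orbT.
- by exists (svert i (Some j)); rewrite col /= !eqxx.
Qed.

End Coloring.

(** * Colorings that attain the bounds *)

Lemma distinct_edges_colorable k :
  3 < k -> n <= k -> k <= 2 * n -> k <= t + 3 -> b_colorable K k.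
Proof.
move=> k3 nk k2n kt3.
pose ce := widen_ord nk.
have ce_eq i j : (ce i == ce j) = (i == j) by rewrite -!val_eqE.
(* Centre i, and likewise cycle vertex i, gets color n+i while this is below k. Otherwise it takes
   the color of edge i+1, which differs from those of edges i and i-1 since n > 2. *)
pose z (i : 'I_n) :=
  match insub (n + i) with Some a => a | None => ce (ordS i) end.
have zce (i : 'I_n) : z i != ce i /\ z i != ce (ord_pred i).
  rewrite /z; case: insubP => [a _ av|_]; last first.
    rewrite !ce_eq ordS_neq; split=> //.
    by rewrite -{1}[i]ord_predK ordS_ordS_neq.
  have lt_z j : ce j < a by rewrite av; apply: ltn_addr; apply: (ltn_ord j).
  have z_neq j : a != ce j by rewrite -val_eqE neq_ltn lt_z orbT.
  by split; apply: z_neq.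
(* The colors open to the leaves of star i: three distinct ones are removed, so k-3 remain, and t
   leaves suffice to show them all. *)
pose free (i : 'I_n) := [set~ ce i] :\ ce (ord_pred i) :\ z i.
have card_free (i : 'I_n) : #|free i| = k - 3.
  have [z1 z2] := zce i.
  have := cardsD1 (z i) ([set~ ce i] :\ ce (ord_pred i)).
  have := cardsD1 (ce (ord_pred i)) [set~ ce i].
  rewrite cardsC1 card_ord !inE z1 z2 ce_eq ord_pred_neq /free; lia.
(* Surplus leaves repeat the first free color, which exists because [3 < k]. *)
pose leaf i j := nth (head (z i) (enum (free i))) (enum (free i)) j.
have leaf_free i j : leaf i j \in free i.
  rewrite -mem_enum /leaf; have: size (enum (free i)) != 0.
    by rewrite -cardE card_free; lia.
  case: (enum (free i)) => //= a l _.
  by case: (ltnP j (size (a :: l))) => [/mem_nth|/(nth_default a)] -> //;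
    rewrite mem_head.
have leaf_surj i a : a \in free i -> exists j : 'I_t, leaf i j = a.
  rewrite -mem_enum => ai; have lt : index a (enum (free i)) < t.
    apply: leq_trans (_ : k - 3 <= t); last lia.
    by rewrite -(card_free i) cardE index_mem.
  by exists (Ordinal lt); rewrite /leaf nth_index.
pose cs i (h : option 'I_t) := if h is Some j then leaf i j else z i.
have csP i h : cs i h != ce i /\ cs i h != ce (ord_pred i).
  case: h => [j|]; last exact: zce.
  by have := leaf_free i j; rewrite !inE => /and3P[].
have cs_surj (i : 'I_n) a : a != ce i -> a != ce (ord_pred i) ->
    exists h, cs i h = a.
  move=> a1 a2; have [->|az] := eqVneq a (z i); first by exists None.
  have [|j <-] := leaf_surj i a; first by rewrite !inE az a1 a2.
  by exists (Some j).
have csSP i h : cs i h != ce i /\ cs (ordS i) h != ce i.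
  by split; [case: (csP i h) | case: (csP (ordS i) h) => _; rewrite ordSK].
apply: (@corona_b_colorable k ce z cs) => [i|//|i j|a].
- exact: (csSP i None).
- by have := leaf_free i j; rewrite /= !inE eq_sym => /and3P[].
have [an|na] := ltnP a n; [left | right].
  exists (Ordinal an); first exact: val_inj.
  set i := Ordinal an => b bi.
  (* Besides the color of edge i itself, star i misses only that of edge i-1. Star i+1 shows it, as
     it misses only edges i and i+1. *)
  have [b_pred|b_pred] := eqVneq b (ce (ord_pred i)); last first.
    by constructor 3; apply: cs_surj.
  constructor 4; apply: cs_surj; last by rewrite ordSK.
  rewrite b_pred ce_eq -{2}[i]ord_predK eq_sym.
  exact: ordS_ordS_neq.
have lt : a - n < n by have := ltn_ord a; lia.
have za : z (Ordinal lt) = a.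
  by apply: val_inj; rewrite /z /= subnKC // valK.
exists (Ordinal lt); rewrite //= => b; rewrite /= za => ba.
have [->|b1] := eqVneq b (ce (Ordinal lt)); first by constructor 1.
have [->|b2] := eqVneq b (ce (ord_pred (Ordinal lt))); first by constructor 2.
by constructor 3; apply: leaf_surj; rewrite !inE za ba b2 b1.
Qed.

Lemma cyclic_edges_colorable k :
  6 <= k -> k <= n -> k <= 2 * t + 5 -> b_colorable K k.
Proof.
move=> k6 kn kt.
have k0 : 0 < k by lia.
pose col m := Ordinal (ltn_pmod m k0).
have colE (a : 'I_k) : col a = a by apply: val_inj; rewrite /= modn_small.
have colP a b : a = b %[mod k] -> col a = col b by move=> ab; apply: val_inj.
have col_shift q d e : d < k -> e < k -> d != e -> col (q + d) != col (q + e).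
  by move=> dk ek; rewrite -val_eqE /= eqn_modDl !modn_small.
have col_neq q d : 0 < d -> d < k -> col (q + d) != col q.
  by move=> d0 dk; rewrite -{2}[q]addn0 col_shift // -lt0n.
(* When n > k, the edges beyond the first k all repeat color 0. *)
pose p (i : 'I_n) := if i < k then (i : nat) else 0.
have p_step (i : 'I_n) : i < k -> p (ordS i) = (p i).+1 %[mod k].
  move=> ik; rewrite /p ik /=; have := ltn_ord i.
  rewrite leq_eqVlt => /predU1P[e|lt].
    by rewrite e modnn k0 mod0n (_ : n = k) ?modnn //; lia.
  rewrite (modn_small lt); case: ltnP => // ki.
  by rewrite (_ : i.+1 = k) ?modnn ?mod0n //; lia.
have p_stay (i : 'I_n) : k <= i -> p (ordS i) = p i.
  move=> ki; rewrite /p /= [i < k]ltnNge ki /=; have := ltn_ord i.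
  rewrite leq_eqVlt => /predU1P[e|lt]; first by rewrite e modnn; case: ifP.
  by rewrite (modn_small lt) ltnNge leqW.
(* Seen from edge i, offset d at position i+1 becomes d+1 if i < k and stays d beyond; neither is 0
   modulo k. *)
have next (i : 'I_n) d : 0 < d -> d.+1 < k -> col (p (ordS i) + d) != col (p i).
  move=> d0 dk; case: (ltnP i k) => [/p_step e|/p_stay ->]; last first.
    by apply: col_neq => //; lia.
  rewrite (colP _ ((p i) + d.+1)) ?col_neq //.
  by rewrite -modnDml e modnDml addSnnS.
(* The centre has offset 1 and the leaves 3, 5, ... up to k-3; surplus leaves fall back on 3, which
   is allowed since k is at least 6. As [k <= 2 * t + 5], all odd offsets up to k-3 occur. *)
pose off (h : option 'I_t) :=
  if h is Some j then if 2 * j + 3 <= k - 3 then 2 * j + 3 else 3 else 1.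
have off_bound h : 0 < off h <= k - 3.
  by case: h => [j|] /=; [case: ifP|]; lia.
have off_surj r : odd r -> r <= k - 3 -> exists h, off h = r.
  move=> rodd rk; case: (ltnP r 3) => r3.
    by exists None; case: r rodd r3 {rk} => [|[|[|]]].
  have lt : (r - 3)./2 < t by lia.
  exists (Some (Ordinal lt)); rewrite /=.
  by rewrite (_ : 2 * (r - 3)./2 + 3 = r) ?rk //; lia.
apply: (@corona_b_colorable k (fun i => col (p i))
  (fun i => col (p i + (k - 2)))
  (fun i h => col (p i + off h))) => [i|i h|i j|a].
- by split; [apply: col_neq | apply: next]; lia.
- by have := off_bound h; split; [apply: col_neq | apply: next]; lia.
- by apply: col_shift; rewrite /=; [|case: ifP|case: ifP]; lia.
have an : a < n by apply: leq_trans (ltn_ord a) kn.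
left; exists (Ordinal an); first by rewrite /p /= ltn_ord colE.
set i := Ordinal an => b bi.
have ik : i < k := ltn_ord a.
(* Here r is the cyclic distance from the color of edge i to b. *)
have [r rk rb] : exists2 r, 0 < r < k & b = col (p i + r).
  have bk := ltn_ord b; move: bi; rewrite -val_eqE /= => bi.
  have pi : p i = a by rewrite /p ik.
  move: bi; rewrite pi modn_small // => bi.
  case: (ltnP a b) => ab.
    exists (b - a); first by move: ab bk; clear; lia.
    by apply: val_inj; rewrite /= subnKC ?modn_small // ltnW.
  have {}ab : b < a by rewrite ltn_neqAle bi.
  exists (b + k - a); first by move: ab ik bk; clear; rewrite /=; lia.
  apply: val_inj; rewrite /= subnKC ?modnDr ?modn_small //.
  by rewrite (leq_trans (ltnW ik)) ?leq_addl.
have nextE d : col (p (ordS i) + d) = col (p i + d.+1).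
  by apply: colP; rewrite -modnDml (p_step _ ik) modnDml addSnnS.
(* Offsets k-2 and k-1 come from cycle vertices i and i+1. Of the remaining ones, star i shows the
   odd r, and star i+1 the even r through its odd offset r-1. *)
have [r2|r2] := eqVneq r (k - 2); first by constructor 1; rewrite rb r2.
have [r1|r1] := eqVneq r (k - 1).
  by constructor 2; rewrite rb r1 nextE; congr (col (_ + _)); lia.
have [ro|re] := boolP (odd r).
  constructor 3; have [|h hr] := off_surj r ro; first lia.
  by exists h; rewrite rb hr.
constructor 4; have [||h hr] := off_surj r.-1; [lia | lia |].
by exists h; rewrite rb nextE hr prednK //; case/andP: rk.
Qed.

End Corona.

Theorem theorem13 (n t : nat) (hn : 2 < n) (ht : 2 < t) :
  b_chromatic_number (svn_corona (cycle_graph n) (star_graph t)) =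
  if n <= (t + 3) %/ 2 then 2 * n
  else if (t + 3) %/ 2 < n <= t + 2 then t + 3
  else if t + 3 <= n <= 2 * t + 4 then n
  else 2 * t + 5.
Proof.
have ub k : b_colorable (svn_corona (cycle_graph n) (star_graph t)) k ->
    [/\ k <= 2 * t + 5, t + 3 < k -> k <= n & 4 < k -> k <= 2 * n].
  case/existsP=> c bc; split; first exact: (colors_leq hn bc).
    by apply: (colors_edge_leq hn bc); lia.
  exact: (colors_edge_or_centre_leq hn bc).
have half : (n <= (t + 3) %/ 2) = (2 * n <= t + 3).
  by rewrite leq_divRL // mulnC.
rewrite half ltnNge half -ltnNge.
(* In each of the four ranges the three bounds in [ub] together force the claimed maximum. The
   distinct-edge coloring attains 2n and t+3, the cyclic one n and 2t+5. *)
case: leqP => n2; [|case: ifP => n3; [|case: ifP => n4]];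
  (apply: b_colorable_chromatic; last by move=> k /ub[]; lia).
- by apply: distinct_edges_colorable => //; lia.
- by apply: distinct_edges_colorable => //; lia.
- by apply: cyclic_edges_colorable => //; lia.
- by apply: cyclic_edges_colorable => //; lia.
Qed.
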